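(* Let $p\in\mathbb{N}_0$ and let $A,v,\beta,V_k,H_k,h_{k+1,k}$ be as in the context (exact Arnoldi decomposition at step $k$), with $\mu_2(A)\le0$. Let $\mathrm{tol}$ be a given tolerance and suppose that $$\frac{\beta\, h_{k+1,k}}{(p+1)!}\le \mathrm{tol}$$ holds at the $k$-th step of the Arnoldi (or Lanczos) iteration. Then for every $t>0$ the Krylov approximation $\beta V_k\varphi_p(tH_k)e_1$ of $\varphi_p(tA)v$ in the Krylov subspace $\mathrm{span}(v,Av,\dots,A^{k-1}v)$ has error $l_{p,k}(t)=\beta V_k\varphi_p(tH_k)e_1-\varphi_p(tA)v$ satisfying $$\|l_{p,k}(t)\|_2\le t\cdot\mathrm{tol}.$$
   Context: For $p\in\mathbb{N}_0$, $\varphi_p(z)=\sum_{j=0}^\infty \frac{z^j}{(j+p)!}$ ($\varphi_0=\exp$), and $\varphi_p$ of a square matrix is defined by the same power series. $e_j$ is the $j$-th unit vector. The logarithmic norm is $\mu_2(A)=\max\,\mathrm{spec}\big((A+A^* )/2\big)$. Setting: $A\in\mathbb{C}^{n\times n}$, $0\ne v\in\mathbb{C}^n$, $\beta=\|v\|_2$. After $k$ steps the Arnoldi method (exact arithmetic) for $\mathrm{span}(v,Av,\dots,A^{k-1}v)$ yields $V_k\in\mathbb{C}^{n\times k}$ with orthonormal columns spanning this subspace, $\beta V_ke_1=v$, an upper Hessenberg matrix $H_k=V_k^*AV_k\in\mathbb{C}^{k\times k}$ with real positive lower subdiagonal entries, a number $h_{k+1,k}\ge0$ and a unit vector $v_{k+1}\in\mathbb{C}^n$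 with $V_k^*v_{k+1}=0$, such that $$AV_k=V_kH_k+h_{k+1,k}v_{k+1}e_k^*$$ (the last term being absent if $h_{k+1,k}=0$). *)

(* Defs.v *)
From mathcomp Require Import all_boot all_order all_algebra.
From mathcomp Require Import complex.
From mathcomp Require Import boolp classical_sets reals topology normedtype.
From mathcomp Require Import sequences.

Set Implicit Arguments.
Unset Strict Implicit.
Unset Printing Implicit Defensive.

Import Order.TTheory GRing.Theory Num.Theory.
Import numFieldNormedType.Exports.

Local Open Scope classical_set_scope.
Local Open Scope ring_scope.
Local Open Scope complex_scope.
Local Open Scope sesquilinear_scope.

Definition norm2 (R : realType) (n : nat) (x : 'cV[R[i]]_n) : R :=
  Num.sqrt (\sum_(i < n) Normc.normc (x i ord0) ^+ 2).

Definition unit_vec (R : realType) (n : nat) (j : 'I_n) : 'cV[R[i]]_n :=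
  delta_mx j ord0.

(* The limit is taken for the max-norm topology on matrices, i.e., entrywise.
   Over K = R[i], which is complete, the series converges for every A. *)
Definition phi_mx (K : numFieldType) (n p : nat) (A : 'M[K]_n) : 'M[K]_n :=
  limn (series (fun j : nat => ((j + p)%N`!%:R)^-1 *: A ^+ j)).

(* [eigenvalue] is stated with row eigenvectors, which gives the same set as
   column eigenvectors. *)
Definition spec (R : realType) (n : nat) (M : 'M[R[i]]_n) : set R[i] :=
  [set z | eigenvalue M z].

Definition herm_part (R : realType) (n : nat) (A : 'M[R[i]]_n) : 'M[R[i]]_n :=
  2%:R^-1 *: (A + A^t* ).

(* The spectrum of a Hermitian matrix is finite, real and, for n > 0, nonempty,
   so the real parts are the eigenvalues themselves and the [sup] is a maximum;
   for n = 0 the value is the junk value [sup set0 = 0]. *)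
Definition mu2 (R : realType) (n : nat) (A : 'M[R[i]]_n) : R :=
  sup ((fun z : R[i] => complex.Re z) @` spec (herm_part A)).

Definition krylov_mx (R : realType) (n k : nat) (A : 'M[R[i]]_n)
    (v : 'cV[R[i]]_n) : 'M[R[i]]_(n, k) :=
  \matrix_(i < n, j < k) (A ^+ j *m v) i ord0.

(* The decomposition after k.+1 steps (so that at least one step was done):
   [H] is H_{k+1}, [h] is h_{k+2,k+1} and [w] is v_{k+2}.  When [h = 0] the
   vector [w] is unconstrained, since its term is then absent (and, if
   k.+1 = n, no unit vector orthogonal to the columns of [V] exists).
   In [R[i]], [0 < z] means that z is real and positive.  Row spaces of the
   transposes are compared because the columns of [V] span the Krylov space. *)
Record arnoldi_decomposition (R : realType) (n k : nat) (A : 'M[R[i]]_n)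
    (v : 'cV[R[i]]_n) (V : 'M[R[i]]_(n, k.+1)) (H : 'M[R[i]]_k.+1) (h : R)
    (w : 'cV[R[i]]_n) : Prop := ArnoldiDecomposition {
  arnoldi_orthonormal : V^t* *m V = 1%:M;
  arnoldi_span : (V^T == (krylov_mx k.+1 A v)^T)%MS;
  arnoldi_first : (norm2 v)%:C *: (V *m unit_vec R ord0) = v;
  arnoldi_proj : H = V^t* *m A *m V;
  arnoldi_hessenberg : forall i j : 'I_k.+1, (j.+1 < i)%N -> H i j = 0;
  arnoldi_subdiag : forall i j : 'I_k.+1, i = j.+1 :> nat -> 0 < H i j;
  arnoldi_h_ge0 : 0 <= h;
  arnoldi_next_unit : h != 0 -> norm2 w = 1;
  arnoldi_next_orth : h != 0 -> V^t* *m w = 0;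
  arnoldi_rel : A *m V = V *m H + h%:C *: (w *m (unit_vec R ord_max)^t*)
}.

Definition krylov_approx (R : realType) (n k p : nat) (v : 'cV[R[i]]_n)
    (V : 'M[R[i]]_(n, k.+1)) (H : 'M[R[i]]_k.+1) (t : R) : 'cV[R[i]]_n :=
  (norm2 v)%:C *: (V *m phi_mx p (t%:C *: H) *m unit_vec R ord0).

Definition krylov_error (R : realType) (n k p : nat) (A : 'M[R[i]]_n)
    (v : 'cV[R[i]]_n) (V : 'M[R[i]]_(n, k.+1)) (H : 'M[R[i]]_k.+1) (t : R) :
    'cV[R[i]]_n :=
  krylov_approx p v V H t - phi_mx p (t%:C *: A) *m v.

(* Main.v *)
(** For a square matrix [B] and a vector [u] put
    [y_p(t) = t^p phi_p(t B) u = \sum_(k >= p) t^k B^(k - p) u / k!].  For every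
    [p] these power series solve [y_p' = B y_p + (t^p / p!)' u] with
    [y_p(0) = u] if [p = 0] and [0] otherwise, so no integral representation of
    [phi_p] is needed.

    If [Re <x, B x> <= 0] for all [x], then [y' = B y + g] with
    [norm2 (g t) <= G'(t)] gives [norm2 (y t) <= norm2 (y 0) + G(t) - G(0)].
    The condition [mu2 A <= 0] means exactly this dissipativity, by the spectral
    theorem for the Hermitian part, and it passes to the compression
    [H = V^* A V].  A first application, to [B = H], gives
    [norm2 (t^p phi_p(t H) e_1) <= t^p / p!].  The Arnoldi relation shows that
    [t^p l_(p,k)(t)] solves an equation with operator [A], initial value [0] and
    source [- beta h (e_k^* t^p phi_p(t H) e_1) w]; a second application, with
    [G(t) = beta h t^(p+1) / (p+1)!], bounds it by [beta h t^(p+1) / (p+1)!]. *)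

Require Import Defs.
From mathcomp Require Import all_boot all_order all_algebra.
From mathcomp Require Import complex reals.
From mathcomp Require Import boolp classical_sets functions topology normedtype.
From mathcomp Require Import sequences derive realfun exp ring lra.

Set Implicit Arguments.
Unset Strict Implicit.
Unset Printing Implicit Defensive.

Import Order.TTheory GRing.Theory Num.Theory.
Import numFieldNormedType.Exports.

Local Open Scope classical_set_scope.
Local Open Scope ring_scope.
Local Open Scope complex_scope.
Local Open Scope sesquilinear_scope.

Local Notation re := (@complex.Re _).
Local Notation im := (@complex.Im _).

(** * The real inner product on complex vectors *)

Section RealPart.
Context {R : realType}.
Implicit Types z w : R[i].

Lemma re_sum (I : Type) (r : seq I) (P : pred I) (F : I -> R[i]) :
  re (\sum_(i <- r | P i) F i) = \sum_(i <- r | P i) re (F i).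
Proof. by apply: (big_morph re) => // -[a b] [c d]. Qed.

Lemma im_sum (I : Type) (r : seq I) (P : pred I) (F : I -> R[i]) :
  im (\sum_(i <- r | P i) F i) = \sum_(i <- r | P i) im (F i).
Proof. by apply: (big_morph im) => // -[a b] [c d]. Qed.

Lemma reD z w : re (z + w) = re z + re w. Proof. by case: z w => a b []. Qed.
Lemma imD z w : im (z + w) = im z + im w. Proof. by case: z w => a b []. Qed.
Lemma reN z : re (- z) = - re z. Proof. by case: z. Qed.
Lemma imN z : im (- z) = - im z. Proof. by case: z. Qed.
Lemma reM z w : re (z * w) = re z * re w - im z * im w.
Proof. by case: z w => a b []. Qed.
Lemma imM z w : im (z * w) = re z * im w + im z * re w.
Proof. by case: z w => a b []. Qed.
Lemma reJ z : re (z^*) = re z. Proof. by case: z. Qed.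
Lemma imJ z : im (z^*) = - im z. Proof. by case: z. Qed.
Lemma conjCE z : Num.conj z = z^*. Proof. by []. Qed.

Lemma realC_natV (m : nat) : (m%:R^-1 : R[i]) = (m%:R^-1 : R)%:C.
Proof. by rewrite -[m%:R in LHS](rmorph_nat (real_complex R)) -fmorphV. Qed.

End RealPart.

Section RealInnerProduct.
Context {R : realType}.

(** The real part makes this the Euclidean inner product of R^(2n): symmetric, bilinear over the
    reals, and inducing [norm2]. The energy estimates thus stay within real calculus. *)
Definition redot (n : nat) (x y : 'cV[R[i]]_n) : R := re ((x^t* *m y) 0 0).

Lemma redotE n (x y : 'cV[R[i]]_n) :
  redot x y =
  \sum_i (re (x i 0) * re (y i 0) + im (x i 0) * im (y i 0)).
Proof.
rewrite /redot mxE re_sum; apply: eq_bigr => i _.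
by rewrite !mxE conjCE reM reJ imJ mulNr opprK.
Qed.

Lemma normc_sqr (z : R[i]) : Normc.normc z ^+ 2 = re z ^+ 2 + im z ^+ 2.
Proof. by case: z => a b; rewrite sqr_sqrtr // addr_ge0 ?sqr_ge0. Qed.

Lemma norm2_ge0 n (x : 'cV[R[i]]_n) : 0 <= norm2 x.
Proof. exact: sqrtr_ge0. Qed.

Lemma redotxx_ge0 n (x : 'cV[R[i]]_n) : 0 <= redot x x.
Proof. by rewrite redotE sumr_ge0 // => i _; rewrite -!expr2 addr_ge0 ?sqr_ge0. Qed.

Lemma norm2_redot n (x : 'cV[R[i]]_n) : norm2 x = Num.sqrt (redot x x).
Proof.
by rewrite redotE /norm2; congr Num.sqrt; apply: eq_bigr => i _; rewrite normc_sqr !expr2.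
Qed.

Lemma norm2_sqr n (x : 'cV[R[i]]_n) : norm2 x ^+ 2 = redot x x.
Proof. by rewrite norm2_redot sqr_sqrtr ?redotxx_ge0. Qed.

Lemma redotC n (x y : 'cV[R[i]]_n) : redot x y = redot y x.
Proof. by rewrite !redotE; apply: eq_bigr => i _; ring. Qed.

Lemma redotDr n (x y z : 'cV[R[i]]_n) : redot x (y + z) = redot x y + redot x z.
Proof. by rewrite /redot mulmxDr mxE reD. Qed.

Lemma redotZr n (x y : 'cV[R[i]]_n) (a : R) :
  redot x (a%:C *: y) = a * redot x y.
Proof. by rewrite /redot -scalemxAr mxE reM /= mul0r subr0. Qed.

Lemma norm2Z n (a : R) (x : 'cV[R[i]]_n) : norm2 (a%:C *: x) = `|a| * norm2 x.
Proof.
by rewrite !norm2_redot redotZr redotC redotZr mulrA -expr2 sqrtrM ?sqr_ge0 // sqrtr_sqr.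
Qed.

Lemma norm20 n : norm2 (0 : 'cV[R[i]]_n) = 0.
Proof. by rewrite norm2_redot /redot mulmx0 mxE sqrtr0. Qed.

Lemma redot_le n (x y : 'cV[R[i]]_n) : redot x y <= norm2 x * norm2 y.
Proof.
have [y0|y0] := eqVneq (redot y y) 0; last first.
  have yy : 0 < redot y y by rewrite lt_neqAle eq_sym y0 redotxx_ge0.
  rewrite (le_trans (ler_norm _)) // -(ler_sqr (normr_ge0 _)) ?nnegrE ?mulr_ge0 ?norm2_ge0 //.
  rewrite real_normK ?num_real // exprMn !norm2_sqr.
  set a := redot x y; set b := redot y y.
  (* Cauchy-Schwarz: the square of [b x - a y] expands to [b (b <x,x> - a^2)], and [b > 0] can be
     cancelled. *)
  have := redotxx_ge0 (b%:C *: x + (- a)%:C *: y).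
  rewrite !redotDr !redotZr ![redot (_ + _) _]redotC !redotDr !redotZr (redotC y x) -/a -/b.
  by move=> h; rewrite -(ler_pM2l yy) -/b -subr_ge0; apply: le_trans h _; lra.
have yz i : re (y i 0) = 0 /\ im (y i 0) = 0.
  move/eqP: y0; rewrite redotE psumr_eq0; last first.
    by move=> j _; rewrite -!expr2 addr_ge0 ?sqr_ge0.
  move/allP/(_ i); rewrite mem_index_enum => /(_ isT) /=.
  by rewrite -!expr2 paddr_eq0 ?sqr_ge0 // !sqrf_eq0 => /andP[/eqP-> /eqP->].
rewrite redotE big1 ?mulr_ge0 ?norm2_ge0 // => i _.
by have [-> ->] := yz i; rewrite !mulr0 addr0.
Qed.

Lemma normc_le_norm2 n (x : 'cV[R[i]]_n) i : Normc.normc (x i 0) <= norm2 x.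
Proof.
rewrite -ler_sqr ?nnegrE ?norm2_ge0 //; last by case: (x i 0) => a b; exact: sqrtr_ge0.
rewrite norm2_sqr normc_sqr redotE (bigD1 i) //= !expr2 lerDl sumr_ge0 // => j _.
by rewrite -!expr2 addr_ge0 ?sqr_ge0.
Qed.

(** * Hermitian part, spectrum and dissipativity *)

Lemma adjmxM m n p (A : 'M[R[i]]_(m, n)) (B : 'M[R[i]]_(n, p)) :
  (A *m B)^t* = B^t* *m A^t*.
Proof. by rewrite trmx_mul map_mxM. Qed.

(** Since Re <x, A^* x> = Re <A x, x> = Re <x, A x>, the skew-Hermitian part contributes nothing. *)
Lemma redot_herm_part n (A : 'M[R[i]]_n) (x : 'cV[R[i]]_n) :
  redot x (herm_part A *m x) = redot x (A *m x).
Proof.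
rewrite /herm_part realC_natV -scalemxAl redotZr mulmxDl redotDr.
have -> : redot x (A^t* *m x) = redot x (A *m x).
  rewrite [RHS]redotC /redot; congr (re (_ 0 0)).
  by rewrite adjmxM mulmxA.
by field.
Qed.

(** A row eigenvector [x] of P^-1 D P becomes the row eigenvector x P^-1 of D, and any nonzero
    coordinate of it identifies the eigenvalue. Conversely, row [i] of [P] is an eigenvector for
    [d 0 i]. *)
Lemma spec_unitary_diag n (P : 'M[R[i]]_n) (d : 'rV[R[i]]_n) (z : R[i]) :
  P \in unitmx -> spec (invmx P *m diag_mx d *m P) z <-> exists i, z = d 0 i.
Proof.
move=> Pu; split=> [/eigenvalueP [x xz x0]|[i ->]].
  have : x *m invmx P *m diag_mx d = z *: (x *m invmx P).
    by rewrite !mulmxA in xz; rewrite -[LHS](mulmxK Pu) xz scalemxAl.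
  set y := x *m invmx P => yz.
  have y0 : y != 0.
    by apply: contra x0 => /eqP y0; rewrite -(mulmxKV Pu x) -/y y0 mul0mx.
  have /rV0Pn [j yj] := y0.
  move: (y) yj yz => u uj /rowP/(_ j); rewrite mul_mx_diag !mxE => uz.
  by exists j; apply: (mulIf uj); rewrite -uz mulrC.
apply/eigenvalueP; exists (row i P).
  rewrite rowE -!mulmxA (mulmxA P) mulmxV // mul1mx mulmxA.
  have -> : delta_mx 0 i *m diag_mx d = d 0 i *: delta_mx 0 i :> 'rV_n.
    apply/rowP => j; rewrite mul_mx_diag !mxE mulrC.
    by case: (eqVneq j i) => [->|]; rewrite ?eqxx ?mulr0 ?mulr1 ?mulr0n ?mulr0.
  by rewrite -scalemxAl.
apply/negP => /eqP r0; have : row i P *m invmx P = 0 by rewrite r0 mul0mx.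
rewrite rowE mulmxK // => /rowP/(_ i); rewrite !mxE !eqxx => /eqP.
by rewrite oner_eq0.
Qed.

(** In a unitary eigenbasis of the Hermitian part, the form is the sum of Re d_i |(P x)_i|^2, and
    each Re d_i is at most [mu2 A]. *)
Lemma mu2_dissipative n (A : 'M[R[i]]_n) (x : 'cV[R[i]]_n) :
  mu2 A <= 0 -> redot x (A *m x) <= 0.
Proof.
move=> muA; rewrite -redot_herm_part.
set M := herm_part A.
have /hermitian_normalmx Mn : M \is hermsymmx.
  apply/is_hermitianmxP; rewrite expr0 scale1r.
  apply/matrixP => i j; rewrite !mxE rmorphM rmorphD /= fmorphV rmorph_nat conjCK addrC.
  by [].
have /orthomx_spectralP ME := Mn.
have Pu := spectral_unitarymx M.
set P := spectralmx M in ME Pu; set d := spectral_diag M in ME.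
have Punit : P \in unitmx := unitarymx_unit Pu.
have dle i : re (d 0 i) <= 0.
  apply: le_trans muA; apply: ub_le_sup.
    (* The [sup] dominates the eigenvalues only once their set is known to be bounded above; this
       sum is a bound. *)
    exists (\sum_j `|re (d 0 j)|) => _ [z + <-]; rewrite -/M ME.
    move/(spec_unitary_diag _ _ Punit) => [j ->].
    by rewrite (bigD1 j) //= (le_trans (ler_norm _)) // lerDl sumr_ge0.
  by exists (d 0 i) => //; rewrite -/M ME; apply/spec_unitary_diag => //; exists i.
rewrite ME invmx_unitary // /redot.
have -> : x^t* *m (P^t* *m diag_mx d *m P *m x) = (P *m x)^t* *m (diag_mx d *m (P *m x)).
  by rewrite adjmxM !mulmxA.
rewrite mxE re_sum sumr_le0 // => i _.
move: (P *m x) => y; rewrite mul_diag_mx !mxE conjCE mulrCA reM.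
have -> : im ((y i 0)^* * y i 0) = 0 by rewrite imM reJ imJ; ring.
rewrite mulr0 subr0 mulr_le0_ge0 // reM reJ imJ mulNr opprK.
by rewrite -!expr2 addr_ge0 ?sqr_ge0.
Qed.

End RealInnerProduct.

(** * Dissipative linear differential equations *)

Section Dissipative.
Context {R : realType}.

(** The variable is real, so splitting each entry into real and imaginary parts leaves only
    derivatives of real functions. *)
Definition mx_is_derive (m n : nat) (y : R -> 'M[R[i]]_(m, n)) (t : R)
    (d : 'M[R[i]]_(m, n)) : Prop :=
  forall i j, is_derive t (1 : R) (fun s => re (y s i j)) (re (d i j)) /\
              is_derive t (1 : R) (fun s => im (y s i j)) (im (d i j)).

Lemma is_derive_sumr n (f : 'I_n -> R -> R) (df : 'I_n -> R) (t : R) :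
  (forall i, is_derive t 1 (f i) (df i)) ->
  is_derive t 1 (fun s => \sum_i f i s) (\sum_i df i).
Proof.
move=> fd; have -> : (fun s => \sum_i f i s) = \sum_i f i.
  by apply/funext => s; rewrite fct_sumE.
exact: is_derive_sum.
Qed.

Lemma mx_is_deriveM m n q (M : 'M[R[i]]_(m, n)) (y : R -> 'M[R[i]]_(n, q)) t d :
  mx_is_derive y t d -> mx_is_derive (fun s => M *m y s) t (M *m d).
Proof.
move=> yd i j; split.
- have -> : (fun s => re ((M *m y s) i j)) =
      fun s => \sum_l (re (M i l) * re (y s l j) - im (M i l) * im (y s l j)).
    by apply/funext => s; rewrite mxE re_sum; apply: eq_bigr => l _; rewrite reM.
  rewrite mxE re_sum; apply: is_derive_sumr => l; rewrite reM.
  have [? ?] := yd l j.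
  by apply: is_derive_eq; rewrite /GRing.scale /=; ring.
- have -> : (fun s => im ((M *m y s) i j)) =
      fun s => \sum_l (re (M i l) * im (y s l j) + im (M i l) * re (y s l j)).
    by apply/funext => s; rewrite mxE im_sum; apply: eq_bigr => l _; rewrite imM.
  rewrite mxE im_sum; apply: is_derive_sumr => l; rewrite imM.
  have [? ?] := yd l j.
  by apply: is_derive_eq; rewrite /GRing.scale /=; ring.
Qed.

Lemma mx_is_deriveB m n (y z : R -> 'M[R[i]]_(m, n)) t dy dz :
  mx_is_derive y t dy -> mx_is_derive z t dz ->
  mx_is_derive (fun s => y s - z s) t (dy - dz).
Proof.
move=> yd zd i j; have [? ?] := yd i j; have [? ?] := zd i j; split.
- under eq_fun do rewrite !mxE reD reN.
  by rewrite !mxE reD reN; apply: is_deriveB.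
- under eq_fun do rewrite !mxE imD imN.
  by rewrite !mxE imD imN; apply: is_deriveB.
Qed.

Lemma is_derive_redot n (y : R -> 'cV[R[i]]_n) t d :
  mx_is_derive y t d ->
  is_derive t (1 : R) (fun s => redot (y s) (y s)) (2 * redot (y t) d).
Proof.
move=> yd; under eq_fun do rewrite redotE.
rewrite redotE mulr_sumr; apply: is_derive_sumr => i.
have [? ?] := yd i 0; apply: is_derive_eq.
by rewrite /GRing.scale /=; ring.
Qed.

(* The square root is smoothed by [e ^+ 2] because [norm2 \o y] need not be
   differentiable where [y] vanishes. *)
Lemma dissipative_norm2_le n (B : 'M[R[i]]_n) (y g : R -> 'cV[R[i]]_n)
    (G dG : R -> R) :
  (forall x, redot x (B *m x) <= 0) ->
  (forall t, mx_is_derive y t (B *m y t + g t)) ->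
  (forall t : R, is_derive t (1 : R) G (dG t)) ->
  (forall t, 0 < t -> norm2 (g t) <= dG t) ->
  forall t, 0 <= t -> norm2 (y t) <= norm2 (y 0) + (G t - G 0).
Proof.
move=> Bdiss yd Gd gG t t0; apply/ler_addgt0Pr => e e0.
pose f s := Num.sqrt (redot (y s) (y s) + e ^+ 2) - G s.
have pos s : 0 < redot (y s) (y s) + e ^+ 2.
  by rewrite ltr_wpDl ?redotxx_ge0 // exprn_gt0.
have fd s : is_derive s (1 : R) f
    (redot (y s) (B *m y s + g s) / Num.sqrt (redot (y s) (y s) + e ^+ 2) - dG s).
  have h1 := is_derive_redot (yd s).
  have h2 := is_derive1_sqrt (pos s).
  have h3 : is_derive s (1 : R) (fun s => redot (y s) (y s) + e ^+ 2)
      (2 * redot (y s) (B *m y s + g s)).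
    by apply: is_derive_eq; rewrite addr0.
  apply: is_deriveB.
  have -> : redot (y s) (B *m y s + g s) / Num.sqrt (redot (y s) (y s) + e ^+ 2) =
      (2 * Num.sqrt (redot (y s) (y s) + e ^+ 2))^-1 *
      (2 * redot (y s) (B *m y s + g s)).
    by field; rewrite gt_eqF // sqrtr_gt0.
  exact: is_derive1_comp.
(* By dissipativity and Cauchy-Schwarz, the numerator of the first term of f' is at most norm2 y *
   norm2 g, hence at most the square root times [dG]. *)
have fle : f t <= f 0.
  apply: (@ler0_derive1_nincr _ f 0 t) => //.
  - move=> x; rewrite in_itv /= => /andP[x0 xt].
    rewrite derive1E (@derive_val _ _ _ _ _ _ _ (fd x)) subr_le0.
    rewrite ler_pdivrMr ?sqrtr_gt0 // redotDr.
    have h : redot (y x) (g x) <= norm2 (y x) * norm2 (g x) := redot_le _ _.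
    have h1 : norm2 (y x) <= Num.sqrt (redot (y x) (y x) + e ^+ 2).
      by rewrite norm2_redot ler_wsqrtr // lerDl sqr_ge0.
    have h2 : norm2 (y x) * norm2 (g x) <= Num.sqrt (redot (y x) (y x) + e ^+ 2) * dG x.
      by apply: ler_pM; rewrite ?norm2_ge0 // gG.
    rewrite mulrC; apply: le_trans h2; apply: le_trans h.
    by rewrite gerDr.
  - by apply: derivable_within_continuous => x _; case: (fd x).
have h1 : norm2 (y t) <= Num.sqrt (redot (y t) (y t) + e ^+ 2).
  by rewrite norm2_redot ler_wsqrtr // lerDl sqr_ge0.
(* The smoothing costs at most [e] at time 0, and [e] is arbitrary. *)
have h2 : Num.sqrt (redot (y 0) (y 0) + e ^+ 2) <= norm2 (y 0) + e.
  rewrite -norm2_sqr -[leRHS]ger0_norm ?addr_ge0 ?norm2_ge0 ?(ltW e0) //.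
  rewrite -sqrtr_sqr ler_wsqrtr // sqrrD lerD2r lerDl.
  by rewrite mulrn_wge0 // mulr_ge0 ?norm2_ge0 // ltW.
move: fle; rewrite /f; lra.
Qed.

End Dissipative.

(** * Convergence of matrix power series *)

(* The field is abstract because [R[i]] gets its topology only through its
   [numFieldType] structure, as in [phi_mx]. *)
Lemma limn_mx (K : numFieldType) (m n : nat) (s : nat -> 'M[K]_(m, n)) (L : 'M[K]_(m, n)) :
  (forall e : K, 0 < e ->
    \forall N \near \oo, forall i j, `|L i j - s N i j| < e) ->
  limn s = L.
Proof.
move=> sL; apply: cvg_lim; first exact: norm_hausdorff.
apply/cvg_ballP => e e0; near=> N; split=> // i j.
by rewrite -ball_normE /=; move: i j; near: N; exact: sL.
Unshelve. all: by end_near. Qed.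

Section MatrixPowerSeries.
Context {R : realType}.

(** Real and imaginary parts are followed separately so that real limit theorems apply;
    [mx_cvg_norm] and [limn_mx] lead back to the matrix limit in [phi_mx]. *)
Definition mx_cvg (m n : nat) (s : nat -> 'M[R[i]]_(m, n)) (L : 'M[R[i]]_(m, n)) :=
  forall i j, (re (s N i j) @[N --> \oo] --> re (L i j)) /\
              (im (s N i j) @[N --> \oo] --> im (L i j)).

Lemma mx_cvg_unique m n (s : nat -> 'M[R[i]]_(m, n)) L L' :
  mx_cvg s L -> mx_cvg s L' -> L = L'.
Proof.
move=> sL sL'; apply/matrixP => i j.
have [h1 h2] := sL i j; have [h3 h4] := sL' i j.
apply/eqP; rewrite eq_complex; apply/andP; split; apply/eqP.
  by rewrite -(cvg_lim _ h1) // -(cvg_lim _ h3).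
by rewrite -(cvg_lim _ h2) // -(cvg_lim _ h4).
Qed.

Lemma cvg_sumr n (f : 'I_n -> nat -> R) (l : 'I_n -> R) :
  (forall i, f i N @[N --> \oo] --> l i) ->
  \sum_i f i N @[N --> \oo] --> \sum_i l i.
Proof. by move=> fl; apply: cvg_big => //; exact: add_continuous. Qed.

Lemma mx_cvgMl m n q (B : 'M[R[i]]_(m, n)) (s : nat -> 'M[R[i]]_(n, q)) L :
  mx_cvg s L -> mx_cvg (fun N => B *m s N) (B *m L).
Proof.
move=> sL i j; split.
- rewrite mxE re_sum; under eq_fun do rewrite mxE re_sum.
  apply: cvg_sumr => l; rewrite reM; under eq_fun do rewrite reM.
  by have [h1 h2] := sL l j; apply: cvgB; apply: cvgM => //; exact: cvg_cst.
- rewrite mxE im_sum; under eq_fun do rewrite mxE im_sum.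
  apply: cvg_sumr => l; rewrite imM; under eq_fun do rewrite imM.
  by have [h1 h2] := sL l j; apply: cvgD; apply: cvgM => //; exact: cvg_cst.
Qed.

Lemma mx_cvgMr m n q (B : 'M[R[i]]_(n, q)) (s : nat -> 'M[R[i]]_(m, n)) L :
  mx_cvg s L -> mx_cvg (fun N => s N *m B) (L *m B).
Proof.
move=> sL i j; split.
- rewrite mxE re_sum; under eq_fun do rewrite mxE re_sum.
  apply: cvg_sumr => l; rewrite reM; under eq_fun do rewrite reM.
  by have [h1 h2] := sL i l; apply: cvgB; apply: cvgM => //; exact: cvg_cst.
- rewrite mxE im_sum; under eq_fun do rewrite mxE im_sum.
  apply: cvg_sumr => l; rewrite imM; under eq_fun do rewrite imM.
  by have [h1 h2] := sL i l; apply: cvgD; apply: cvgM => //; exact: cvg_cst.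
Qed.

Lemma mx_cvgD m n (s s' : nat -> 'M[R[i]]_(m, n)) L L' :
  mx_cvg s L -> mx_cvg s' L' -> mx_cvg (fun N => s N + s' N) (L + L').
Proof.
move=> sL sL' i j; have [h1 h2] := sL i j; have [h3 h4] := sL' i j; split.
- by rewrite mxE reD; under eq_fun do rewrite mxE reD; apply: cvgD.
- by rewrite mxE imD; under eq_fun do rewrite mxE imD; apply: cvgD.
Qed.

Lemma mx_cvg_near_cst m n (s : nat -> 'M[R[i]]_(m, n)) L :
  (\forall N \near \oo, s N = L) -> mx_cvg s L.
Proof.
by move=> sL i j; split; apply: cvg_near_cst; near=> N;
  have -> : s N = L by near: N.
Unshelve. all: by end_near. Qed.

Lemma mx_cvg_shift m n p (s : nat -> 'M[R[i]]_(m, n)) L :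
  mx_cvg s L -> mx_cvg (fun N => s (N + p)%N) L.
Proof.
move=> sL i j; have [h1 h2] := sL i j; split.
- by rewrite -(cvg_shiftn p) in h1.
- by rewrite -(cvg_shiftn p) in h2.
Qed.

Lemma normc_le_abs (z : R[i]) : Normc.normc z <= `|re z| + `|im z|.
Proof.
rewrite -ler_sqr ?nnegrE ?addr_ge0 //; last by case: z => a b; exact: sqrtr_ge0.
rewrite normc_sqr sqrrD !real_normK ?num_real // [leRHS]addrAC lerDl.
by rewrite mulrn_wge0 // mulr_ge0.
Qed.

Lemma mx_cvg_norm m n (s : nat -> 'M[R[i]]_(m, n)) L (e : R[i]) :
  mx_cvg s L -> 0 < e ->
  \forall N \near \oo, forall i j, `|L i j - s N i j| < e.
Proof.
move=> sL e0.
(* A positive element of [R[i]] is real. Half of it is allotted to each of the real and imaginary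
   parts. *)
have [e' e'0 ->] : exists2 e' : R, 0 < e' & e = e'%:C.
  exists (re e); last by rewrite RRe_real // gtr0_real.
  by move: e0; rewrite ltcE => /andP[].
have e2 : 0 < e' / 2 by rewrite divr_gt0.
have near_entry (ij : 'I_m * 'I_n) : \forall N \near \oo,
    `|re (L ij.1 ij.2 - s N ij.1 ij.2)| < e' / 2 /\
    `|im (L ij.1 ij.2 - s N ij.1 ij.2)| < e' / 2.
  have [/cvgrPdist_lt/(_ _ e2) h1 /cvgrPdist_lt/(_ _ e2) h2] := sL ij.1 ij.2.
  by near=> N; split; rewrite ?(reD, imD, reN, imN); near: N.
(* There are finitely many entries, so one threshold serves them all. *)
move/filter_forall: near_entry => /= near_entry.
near=> N => i j; rewrite normc_def ltcR.
have [h1 h2] : `|re (L i j - s N i j)| < e' / 2 /\ `|im (L i j - s N i j)| < e' / 2.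
  move: i j; suff : forall ij : 'I_m * 'I_n, `|re (L ij.1 ij.2 - s N ij.1 ij.2)| < e' / 2 /\
      `|im (L ij.1 ij.2 - s N ij.1 ij.2)| < e' / 2 by move=> h i j; exact: h (i, j).
  by near: N.
have := normc_le_abs (L i j - s N i j); case: (L i j - s N i j) h1 h2 => a b /=.
lra.
Unshelve. all: by end_near. Qed.

End MatrixPowerSeries.

(** * Real power series dominated by an exponential series *)

Section ExponentialType.
Context {R : realType}.

(** Domination by the Taylor coefficients of C exp(M x) gives convergence on the whole line and
    survives formal differentiation. *)
Definition exp_type (c : nat -> R) : Prop :=
  exists C M : R, [/\ 0 <= C, 0 <= M & forall k, `|c k| <= C * (M ^+ k / k`!%:R)].

(** The factor k+1 is absorbed by the factorial: (k+1) C M^(k+1) / (k+1)! = (C M) M^k / k!. *)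
Lemma exp_type_diffs (c : nat -> R) : exp_type c -> exp_type (pseries_diffs c).
Proof.
move=> [C [M [C0 M0 cM]]]; exists (C * M), M; split=> // [|k].
  exact: mulr_ge0.
rewrite /pseries_diffs normrM ger0_norm //.
apply: le_trans (ler_wpM2l _ (cM k.+1)) _ => //.
rewrite le_eqVlt; apply/orP; left; apply/eqP.
rewrite factS natrM exprS; field.
by rewrite pnatr_eq0 -lt0n fact_gt0 /= addrC natr1 pnatr_eq0.
Qed.

Lemma exp_type_cvg (c : nat -> R) (x : R) : exp_type c -> cvgn (pseries c x).
Proof.
move=> [C [M [C0 M0 cM]]]; apply: normed_cvg.
apply: (@series_le_cvg _ _ (C *: exp_coeff (M * `|x|))) => //.
- by move=> k; exact: normr_ge0.
- move=> k; rewrite /= -[X in 0 <= X]/(C * _) mulr_ge0 // exp_coeff_ge0 //.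
  exact: mulr_ge0.
- move=> k; rewrite -[leRHS]/(C * ((M * `|x|) ^+ k / k`!%:R)) /=.
  rewrite normrM normrX exprMn.
  apply: le_trans (ler_wpM2r _ (cM k)) _; first exact: exprn_ge0.
  by rewrite le_eqVlt; apply/orP; left; apply/eqP; ring.
- exact/is_cvg_seriesZ/is_cvg_series_exp_coeff.
Qed.

(** Termwise differentiation needs the series and its first two formal derivatives to converge at a
    point beyond |x|; |x| + 1 is taken. *)
Lemma is_derive_pseries (c : nat -> R) (x : R) : exp_type c ->
  is_derive x (1 : R) (fun t => limn (pseries c t)) (limn (pseries (pseries_diffs c) x)).
Proof.
move=> ce; apply: (@pseries_snd_diffs _ c (`|x| + 1)).
- exact: exp_type_cvg.
- exact/exp_type_cvg/exp_type_diffs.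
- exact/exp_type_cvg/exp_type_diffs/exp_type_diffs.
- by rewrite [ltRHS]ger0_norm ?addr_ge0 // ltrDl.
Qed.

End ExponentialType.

(** * The functions [t ^ p phi_p(t B)] *)

Section PhiSeries.
Context {R : realType}.

Definition mx_exp_type (m n : nat) (a : nat -> 'M[R[i]]_(m, n)) : Prop :=
  forall i j, exp_type (fun k => re (a k i j)) /\ exp_type (fun k => im (a k i j)).

Definition mx_pseries (m n : nat) (a : nat -> 'M[R[i]]_(m, n)) (t : R) (N : nat) :
    'M[R[i]]_(m, n) :=
  \sum_(0 <= k < N) (t ^+ k)%:C *: a k.

Definition mx_psum (m n : nat) (a : nat -> 'M[R[i]]_(m, n)) (t : R) : 'M[R[i]]_(m, n) :=
  \matrix_(i, j) (limn (pseries (fun k => re (a k i j)) t) +i*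
                  limn (pseries (fun k => im (a k i j)) t)).

Definition mx_diffs (m n : nat) (a : nat -> 'M[R[i]]_(m, n)) (k : nat) :=
  (k.+1%:R : R)%:C *: a k.+1.

Lemma re_diffs m n (a : nat -> 'M[R[i]]_(m, n)) i j :
  (fun k => re (mx_diffs a k i j)) = pseries_diffs (fun k => re (a k i j)).
Proof. by apply/funext => k; rewrite mxE reM /= mul0r subr0. Qed.

Lemma im_diffs m n (a : nat -> 'M[R[i]]_(m, n)) i j :
  (fun k => im (mx_diffs a k i j)) = pseries_diffs (fun k => im (a k i j)).
Proof. by apply/funext => k; rewrite mxE imM /= mul0r addr0. Qed.

Lemma mx_exp_type_diffs m n (a : nat -> 'M[R[i]]_(m, n)) :
  mx_exp_type a -> mx_exp_type (mx_diffs a).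
Proof.
move=> ae i j; have [? ?] := ae i j.
by rewrite re_diffs im_diffs; split; exact: exp_type_diffs.
Qed.

Lemma re_mx_pseries m n (a : nat -> 'M[R[i]]_(m, n)) t N i j :
  re (mx_pseries a t N i j) = pseries (fun k => re (a k i j)) t N.
Proof.
rewrite /mx_pseries summxE re_sum /pseries /series /=; apply: eq_bigr => k _.
by rewrite mxE reM /= mul0r subr0 mulrC.
Qed.

Lemma im_mx_pseries m n (a : nat -> 'M[R[i]]_(m, n)) t N i j :
  im (mx_pseries a t N i j) = pseries (fun k => im (a k i j)) t N.
Proof.
rewrite /mx_pseries summxE im_sum /pseries /series /=; apply: eq_bigr => k _.
by rewrite mxE imM /= mul0r addr0 mulrC.
Qed.

Lemma mx_pseries_cvg m n (a : nat -> 'M[R[i]]_(m, n)) t :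
  mx_exp_type a -> mx_cvg (mx_pseries a t) (mx_psum a t).
Proof.
move=> ae i j; have [aer aei] := ae i j; split.
- under eq_fun do rewrite re_mx_pseries.
  by rewrite mxE /=; exact: exp_type_cvg.
- under eq_fun do rewrite im_mx_pseries.
  by rewrite mxE /=; exact: exp_type_cvg.
Qed.

Lemma mx_psum_derive m n (a : nat -> 'M[R[i]]_(m, n)) t :
  mx_exp_type a -> mx_is_derive (mx_psum a) t (mx_psum (mx_diffs a) t).
Proof.
move=> ae i j; have [aer aei] := ae i j; split.
- under eq_fun do rewrite mxE.
  by rewrite mxE /= re_diffs; exact: is_derive_pseries.
- under eq_fun do rewrite mxE.
  by rewrite mxE /= im_diffs; exact: is_derive_pseries.
Qed.

(** The Taylor coefficients at 0 of t^p phi_p(t B) U. A general [U] covers both the matrix function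
    (U = 1) and its action on a vector. *)
Definition phi_coef (n q : nat) (B : 'M[R[i]]_n) (U : 'M[R[i]]_(n, q)) (p k : nat) :
    'M[R[i]]_(n, q) :=
  if (k < p)%N then 0 else ((k`!%:R)^-1 : R)%:C *: (B ^+ (k - p) *m U).

Lemma normc_ge0 (z : R[i]) : 0 <= Normc.normc z.
Proof. by case: z => a b; exact: sqrtr_ge0. Qed.

Lemma normc_sum_le (I : Type) (r : seq I) (F : I -> R[i]) :
  Normc.normc (\sum_(i <- r) F i) <= \sum_(i <- r) Normc.normc (F i).
Proof.
elim/big_rec2: _ => [|i x z _ h]; first by rewrite Normc.normc0.
by apply: le_trans (le_normcD _ _) _; rewrite lerD2l.
Qed.

(** The bound [1 <= M] is recorded because the coefficients involve B^(k-p), to be bounded by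
    M^(k-p) <= M^k. *)
Lemma expmx_entry_le n q (B : 'M[R[i]]_n) (U : 'M[R[i]]_(n, q)) :
  exists C M : R, [/\ 0 <= C, 1 <= M &
    forall k i j, Normc.normc ((B ^+ k *m U) i j) <= C * M ^+ k].
Proof.
pose S m' n' (A : 'M[R[i]]_(m', n')) := \sum_i \sum_j Normc.normc (A i j).
have S0 m' n' (A : 'M_(m', n')) : 0 <= S m' n' A.
  by apply: sumr_ge0 => i _; apply: sumr_ge0 => j _; exact: normc_ge0.
have rowS m' n' (A : 'M_(m', n')) i : \sum_j Normc.normc (A i j) <= S m' n' A.
  rewrite /S (bigD1 i) //= lerDl; apply: sumr_ge0 => i' _.
  by apply: sumr_ge0 => j _; exact: normc_ge0.
(* Induction on [k]: multiplying by [B] enlarges the entry bound by at most the sum of the moduli of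
   the entries of [B]. *)
exists (S n q U), (1 + S n n B); split=> //; first by rewrite lerDl.
elim=> [|k IH] i j.
  rewrite expr0 mul1mx expr0 mulr1; apply: le_trans (rowS _ _ _ i).
  by rewrite (bigD1 j) //= lerDl; apply: sumr_ge0 => j' _; exact: normc_ge0.
rewrite exprS -mulmxE -mulmxA mxE; apply: le_trans (normc_sum_le _ _) _.
have -> : S n q U * (1 + S n n B) ^+ k.+1 =
    (1 + S n n B) * (S n q U * (1 + S n n B) ^+ k) by rewrite exprS; ring.
have h : 0 <= S n q U * (1 + S n n B) ^+ k.
  by rewrite mulr_ge0 // exprn_ge0 // addr_ge0.
apply: (@le_trans _ _ (S n n B * (S n q U * (1 + S n n B) ^+ k))); last first.
  by rewrite ler_wpM2r // lerDr.
apply: (@le_trans _ _ (\sum_l Normc.normc (B i l) * (S n q U * (1 + S n n B) ^+ k))).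
  by apply: ler_sum => l _; rewrite Normc.normcM ler_wpM2l ?normc_ge0.
by rewrite -mulr_suml ler_wpM2r.
Qed.

Lemma re_le_normc (z : R[i]) : `|re z| <= Normc.normc z.
Proof. by case: z => a b /=; rewrite -sqrtr_sqr ler_wsqrtr // lerDl sqr_ge0. Qed.

Lemma im_le_normc (z : R[i]) : `|im z| <= Normc.normc z.
Proof. by case: z => a b /=; rewrite -sqrtr_sqr ler_wsqrtr // lerDr sqr_ge0. Qed.

Lemma phi_coef_exp_type n q (B : 'M[R[i]]_n) (U : 'M[R[i]]_(n, q)) p :
  mx_exp_type (phi_coef B U p).
Proof.
have [C [M [C0 M1 BM]]] := expmx_entry_le B U.
have M0 : 0 <= M by rewrite (le_trans _ M1).
suff h i j k : Normc.normc (phi_coef B U p k i j) <= C * (M ^+ k / k`!%:R).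
  move=> i j; split; exists C, M; split=> // k; apply: le_trans (h i j k).
  - exact: re_le_normc.
  - exact: im_le_normc.
have b0 : 0 <= C * (M ^+ k / k`!%:R) by rewrite mulr_ge0 // divr_ge0 // exprn_ge0.
rewrite /phi_coef; case: ltnP => kp; first by rewrite mxE Normc.normc0.
rewrite mxE Normc.normcM.
have -> : Normc.normc ((k`!%:R)^-1 : R)%:C = (k`!%:R)^-1.
  by rewrite /= expr0n addr0 sqrtr_sqr ger0_norm // invr_ge0.
rewrite mulrA [leRHS]mulrC ler_wpM2l ?invr_ge0 //.
apply: le_trans (BM _ i j) _; rewrite ler_wpM2l //.
by rewrite ler_weXn2l // leq_subr.
Qed.

(* [phi_src p t = t ^ (p - 1) / (p - 1)!], which is the derivative of
   [t ^ p / p!]; hence it vanishes for [p = 0]. *)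
Definition phi_src (p : nat) (t : R) : R :=
  if p is p'.+1 then t ^+ p' / p'`!%:R else 0.

Lemma is_derive_phi_src (p : nat) (t : R) :
  is_derive t (1 : R) (fun s => s ^+ p / p`!%:R) (phi_src p t).
Proof.
case: p => [|p].
  by have -> : (fun s : R => s ^+ 0 / 0`!%:R) = cst 1
    by [apply/funext => s; rewrite expr0 divr1]; exact: is_derive_cst.
have -> : (fun s : R => s ^+ p.+1 / (p.+1)`!%:R) = ((p.+1)`!%:R)^-1 *: (id ^+ p.+1).
  by apply/funext => s; rewrite mulrC /= -[RHS]/(_ * _) fctE.
apply: is_derive_eq; rewrite /GRing.scale /= factS natrM -mulr_natl; field.
by rewrite pnatr_eq0 -lt0n fact_gt0 /= addrC natr1 pnatr_eq0.
Qed.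

(** The differential equation read on coefficients: (k+1)/(k+1)! = 1/k! turns each coefficient into
    [B] times its predecessor, except at k+1 = p, where the series starts and the source appears. *)
Lemma mx_diffs_phi_coef n q (B : 'M[R[i]]_n) (U : 'M[R[i]]_(n, q)) p k :
  mx_diffs (phi_coef B U p) k =
  (if k.+1 == p then ((k`!%:R)^-1 : R)%:C *: U else 0) + B *m phi_coef B U p k.
Proof.
rewrite /mx_diffs /phi_coef.
have fE : (k.+1%:R : R)%:C * ((k.+1)`!%:R^-1 : R)%:C = (k`!%:R^-1 : R)%:C.
  rewrite -rmorphM; congr (_ %:C); rewrite factS natrM; field.
  by rewrite pnatr_eq0 -lt0n fact_gt0 /= addrC natr1 pnatr_eq0.
have [kp|kp|kp] := ltngtP k.+1 p.
- by rewrite scaler0 mulmx0 addr0.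
- rewrite scalerA fE add0r -scalemxAr subSn // exprS -mulmxE.
  by rewrite mulmxA.
- by rewrite -kp subnn expr0 mul1mx mulmx0 addr0 scalerA fE.
Qed.

Definition scaled_phi (n q : nat) (B : 'M[R[i]]_n) (U : 'M[R[i]]_(n, q)) (p : nat) (t : R) :=
  mx_psum (phi_coef B U p) t.

Lemma scaled_phi_derive n q (B : 'M[R[i]]_n) (U : 'M[R[i]]_(n, q)) p t :
  mx_is_derive (scaled_phi B U p) t
    (B *m scaled_phi B U p t + (phi_src p t)%:C *: U).
Proof.
have ae := phi_coef_exp_type B U p.
suff -> : B *m scaled_phi B U p t + (phi_src p t)%:C *: U =
    mx_psum (mx_diffs (phi_coef B U p)) t by exact: mx_psum_derive.
apply: (mx_cvg_unique (s := mx_pseries (mx_diffs (phi_coef B U p)) t)); last first.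
  by apply: mx_pseries_cvg; exact: mx_exp_type_diffs.
have -> : mx_pseries (mx_diffs (phi_coef B U p)) t = fun N =>
    B *m mx_pseries (phi_coef B U p) t N +
    \sum_(0 <= k < N) if k.+1 == p then (phi_src p t)%:C *: U else 0.
  apply/funext => N; rewrite /mx_pseries mulmx_sumr -big_split /=.
  apply: eq_bigr => k _; rewrite mx_diffs_phi_coef scalerDr addrC scalemxAr.
  congr (_ + _); case: eqP => [<-|]; last by rewrite scaler0.
  by rewrite /= scalerA -rmorphM.
apply: mx_cvgD; first by apply: mx_cvgMl; exact: mx_pseries_cvg.
(* From N = p on, the sum contains its only possible nonzero term, k = p-1; for p = 0 there is none
   and [phi_src] is 0. *)
apply: mx_cvg_near_cst; exists p => // N /= pN.
case: p {ae} pN => [|p] pN.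
  by rewrite big1 // scale0r.
rewrite big_mkord (bigD1 (Ordinal pN)) //= eqxx big1 ?addr0 // => k kp.
by rewrite eqSS; case: eqP => // kE; case/eqP: kp; exact: val_inj.
Qed.

Lemma scaled_phi0 n q (B : 'M[R[i]]_n) (U : 'M[R[i]]_(n, q)) p :
  scaled_phi B U p 0 = (p == 0)%:R *: U.
Proof.
apply: (mx_cvg_unique (s := mx_pseries (phi_coef B U p) 0)).
  by apply: mx_pseries_cvg; exact: phi_coef_exp_type.
apply: mx_cvg_near_cst; exists 1%N => // -[//|N] _.
rewrite /mx_pseries big_nat_recl // big1 ?addr0 => [|k _]; last first.
  by rewrite exprS mul0r scale0r.
rewrite expr0 scale1r /phi_coef; case: p => [|p] /=; last by rewrite scale0r.
by rewrite invr1 expr0 mul1mx.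
Qed.

Lemma expmxZ (F : comNzRingType) n (c : F) (B : 'M[F]_n) k : (c *: B) ^+ k = c ^+ k *: B ^+ k.
Proof.
elim: k => [|k IH]; first by rewrite !expr0 scale1r.
by rewrite !exprS IH -!mulmxE -scalemxAl -scalemxAr scalerA.
Qed.

(** The first [p] coefficients vanish, and the partial sum of length N+p is t^p times the N-th
    partial sum for phi_p, times U. *)
Lemma scaled_phiE n q (B : 'M[R[i]]_n) (U : 'M[R[i]]_(n, q)) p t : 0 < t ->
  scaled_phi B U p t = (t ^+ p)%:C *: (phi_mx p (t%:C *: B) *m U).
Proof.
move=> t0.
have tp0 : (t ^+ p)%:C != 0 :> R[i] by rewrite fmorph_eq0 expf_neq0 ?gt_eqF.
pose s N : 'M[R[i]]_n := \sum_(0 <= j < N) ((j + p)`!%:R)^-1 *: (t%:C *: B) ^+ j.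
have sE r (V : 'M_(n, r)) N :
    mx_pseries (phi_coef B V p) t (N + p) = ((t ^+ p)%:C)%:M *m (s N *m V).
  rewrite /mx_pseries addnC (@big_cat_nat _ _ _ p) ?leq_addr //=.
  rewrite big_nat big1 ?add0r => [|k /andP[_ kp]]; last by rewrite /phi_coef kp scaler0.
  rewrite -{1}[p]add0n big_addn addnC addnK /s mulmx_suml mulmx_sumr.
  apply: eq_bigr => j _; rewrite /phi_coef ltnNge leq_addl /= addnK.
  rewrite mul_scalar_mx realC_natV expmxZ -!scalemxAl !scalerA; congr (_ *: _).
  by rewrite !rmorphXn exprD; ring.
have tM (X : 'M[R[i]]_n) : ((t ^+ p)%:C^-1)%:M *m (((t ^+ p)%:C)%:M *m X) = X.
  by rewrite !mul_scalar_mx scalerA mulVf ?scale1r.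
(* The case U = 1 supplies convergence of the series defining [phi_mx], hence the value of its
   [limn]. *)
have sc : mx_cvg s (((t ^+ p)%:C^-1)%:M *m mx_psum (phi_coef B 1%:M p) t).
  have -> : s = fun N => ((t ^+ p)%:C^-1)%:M *m mx_pseries (phi_coef B 1%:M p) t (N + p).
    by apply/funext => N; rewrite sE tM mulmx1.
  apply/mx_cvgMl/mx_cvg_shift/mx_pseries_cvg; exact: phi_coef_exp_type.
have phiE : phi_mx p (t%:C *: B) = ((t ^+ p)%:C^-1)%:M *m mx_psum (phi_coef B 1%:M p) t.
  by apply: limn_mx => e e0; exact: (mx_cvg_norm sc e0).
rewrite -phiE in sc.
apply: (mx_cvg_unique (s := fun N => mx_pseries (phi_coef B U p) t (N + p)%N)).
  by apply/mx_cvg_shift/mx_pseries_cvg; exact: phi_coef_exp_type.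
rewrite -mul_scalar_mx; under eq_fun do rewrite sE.
exact/mx_cvgMl/mx_cvgMr.
Qed.

End PhiSeries.

(** * The Krylov error *)

Lemma norm2ZC (R : realType) n (a : R[i]) (x : 'cV[R[i]]_n) :
  norm2 (a *: x) = Normc.normc a * norm2 x.
Proof.
have a0 : 0 <= Normc.normc a by case: a => b c; exact: sqrtr_ge0.
rewrite /norm2 -[X in _ = X * _]ger0_norm // -sqrtr_sqr -sqrtrM ?sqr_ge0 //.
congr Num.sqrt; rewrite mulr_sumr; apply: eq_bigr => i _.
by rewrite mxE Normc.normcM exprMn.
Qed.

Lemma norm2_scaled_phi_le (R : realType) n (B : 'M[R[i]]_n) (u : 'cV[R[i]]_n) p (t : R) :
  (forall x, redot x (B *m x) <= 0) -> norm2 u = 1 -> 0 <= t ->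
  norm2 (scaled_phi B u p t) <= t ^+ p / p`!%:R.
Proof.
move=> Bdiss u1 t0.
apply: le_trans (dissipative_norm2_le (G := fun s => s ^+ p / p`!%:R)
  Bdiss (scaled_phi_derive B u p) (is_derive_phi_src p) _ t0) _.
- move=> s s0; rewrite norm2Z u1 mulr1 ger0_norm // /phi_src.
  by case: (p) => // q; rewrite divr_ge0 // exprn_ge0 // ltW.
(* For p = 0 the initial norm 1 cancels G(0) = 1; for p > 0 both are 0. *)
- rewrite scaled_phi0; case: p => [|p] /=.
    by rewrite scale1r u1 !expr0 subrr addr0 divr1.
  by rewrite scale0r norm20 add0r expr0n /= mul0r subr0.
Qed.

Lemma krylov_error_scaled (R : realType) n k p (A : 'M[R[i]]_n) (v : 'cV[R[i]]_n)
    (V : 'M[R[i]]_(n, k.+1)) (H : 'M[R[i]]_k.+1) (t : R) : 0 < t ->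
  (t ^+ p)%:C *: krylov_error p A v V H t =
  ((norm2 v)%:C *: V) *m scaled_phi H (unit_vec R ord0) p t - scaled_phi A v p t.
Proof.
move=> t0; rewrite !scaled_phiE // /krylov_error /krylov_approx scalerBr.
by rewrite -scalemxAl -!scalemxAr !scalerA mulrC mulmxA.
Qed.

(** The difference of the two right-hand sides, with [c] standing for [phi_src]: the sources cancel
    because beta V e_1 = v, and replacing V H by A V leaves the rank-one Arnoldi remainder, which
    sees only the last entry of [y]. *)
Lemma arnoldi_residual (R : realType) n k (A : 'M[R[i]]_n) (v : 'cV[R[i]]_n)
    (V : 'M[R[i]]_(n, k.+1)) (H : 'M[R[i]]_k.+1) (h : R) (w : 'cV[R[i]]_n)
    (y : 'cV[R[i]]_k.+1) (z : 'cV[R[i]]_n) (c : R[i]) :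
  arnoldi_decomposition A v V H h w ->
  ((norm2 v)%:C *: V) *m (H *m y + c *: unit_vec R ord0) - (A *m z + c *: v) =
  A *m (((norm2 v)%:C *: V) *m y - z) + (- (norm2 v * h))%:C *: (y ord_max 0 *: w).
Proof.
move=> arn.
have yk : (unit_vec R (ord_max : 'I_k.+1))^t* *m y = (y ord_max 0)%:M.
  apply/matrixP => i j; rewrite !ord1 /unit_vec trmx_delta map_delta_mx.
  by rewrite -rowE !mxE eqxx mulr1n.
have VH : V *m H = A *m V - h%:C *: (w *m (unit_vec R ord_max)^t*).
  by rewrite (arnoldi_rel arn) addrK.
have bVe : ((norm2 v)%:C *: V) *m unit_vec R ord0 = v.
  by rewrite -scalemxAl (arnoldi_first arn).
have bVH : ((norm2 v)%:C *: V) *m (H *m y) =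
    A *m (((norm2 v)%:C *: V) *m y) + (- (norm2 v * h))%:C *: (y ord_max 0 *: w).
  rewrite -!scalemxAl -scalemxAr mulmxA VH mulmxBl -scalemxAl -!mulmxA yk.
  by rewrite mul_mx_scalar scalerBr [in LHS]scalerA -rmorphM -scaleNr -rmorphN.
rewrite mulmxDr bVH -scalemxAr bVe opprD addrACA subrr addr0 mulmxBr.
by rewrite addrAC.
Qed.

Theorem proposition5 (R : realType) (n k p : nat)
    (A : 'M[R[i]]_n) (v : 'cV[R[i]]_n)
    (V : 'M[R[i]]_(n, k.+1)) (H : 'M[R[i]]_k.+1) (h : R) (w : 'cV[R[i]]_n)
    (tol : R) :
  v != 0 ->
  arnoldi_decomposition A v V H h w ->
  mu2 A <= 0 ->
  norm2 v * h / (p.+1)`!%:R <= tol ->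
  forall t : R, 0 < t ->
    norm2 (krylov_error p A v V H t) <= t * tol.
Proof.
move=> _ arn muA htol t t0.
have Adiss x : redot x (A *m x) <= 0 := mu2_dissipative x muA.
have Hdiss x : redot x (H *m x) <= 0.
  (* Dissipativity passes to the compression: <x, V^* A V x> = <V x, A V x>. *)
  suff -> : redot x (H *m x) = redot (V *m x) (A *m (V *m x)) by exact: Adiss.
  by rewrite (arnoldi_proj arn) /redot adjmxM !mulmxA.
set b := norm2 v in htol.
have bh0 : 0 <= b * h by rewrite mulr_ge0 ?norm2_ge0 ?(arnoldi_h_ge0 arn).
set e1 : 'cV[R[i]]_k.+1 := unit_vec R ord0.
have e1n : norm2 e1 = 1.
  rewrite /norm2 (bigD1 ord0) //= big1 => [|i i0].
    by rewrite mxE !eqxx Normc.normc1 expr1n addr0 sqrtr1.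
  by rewrite mxE (negbTE i0) Normc.normc0 expr0n.
pose y := scaled_phi H e1 p; pose z := scaled_phi A v p.
pose E s := (b%:C *: V) *m y s - z s.
pose g s := (- (b * h))%:C *: (y s ord_max 0 *: w).
have Ed s : mx_is_derive E s (A *m E s + g s).
  rewrite -(arnoldi_residual _ _ (phi_src p s)%:C arn).
  by apply: mx_is_deriveB; [apply: mx_is_deriveM|]; exact: scaled_phi_derive.
have Gd (s : R) : is_derive s (1 : R) (fun s => b * h * (s ^+ p.+1 / (p.+1)`!%:R))
    (b * h * phi_src p.+1 s).
  exact: (is_deriveZ (b * h) (is_derive_phi_src p.+1 s)).
have gG s : 0 < s -> norm2 (g s) <= b * h * phi_src p.+1 s.
  move=> s0; rewrite norm2Z normrN ger0_norm // norm2ZC.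
  (* For h = 0 the vector [w] is unconstrained, but both sides vanish. *)
  have [->|h0] := eqVneq h 0; first by rewrite mulr0 !mul0r.
  rewrite (arnoldi_next_unit arn h0) mulr1 ler_wpM2l //.
  (* The last entry is bounded by the whole vector, hence by s^p/p!, which is [phi_src p.+1 s]. *)
  apply: le_trans (normc_le_norm2 _ _) _.
  exact: norm2_scaled_phi_le (ltW s0).
have := dissipative_norm2_le Adiss Ed Gd gG (ltW t0).
have -> : E 0 = 0.
  rewrite /E /y /z !scaled_phi0 -scalemxAr -scalemxAl (arnoldi_first arn).
  by rewrite subrr.
(* The exponent p+1 is positive, so G(0) = 0 for every [p]. *)
rewrite /E -krylov_error_scaled // norm2Z norm20 add0r expr0n /= mul0r mulr0 subr0.
have tp : 0 < t ^+ p by rewrite exprn_gt0.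
rewrite ger0_norm ?(ltW tp) // => le_err.
rewrite -(ler_pM2l tp); apply: le_trans le_err _.
have -> : b * h * (t ^+ p.+1 / (p.+1)`!%:R) = t ^+ p * (t * (b * h / (p.+1)`!%:R)).
  by rewrite exprS; ring.
by rewrite ler_pM2l // ler_pM2l.
Qed.
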